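(* Let $a_{4,0},a_{2,2},a_{0,4}\geqslant0$ with $a_{4,0}+a_{2,2}>0$, $a_{2,2}+a_{0,4}>0$, let $t\in\mathbb{R}$ and $W_t(x,y)=e^{-(a_{4,0}x^4+a_{2,2}x^2y^2+a_{0,4}y^4)+t(x^2+y^2)}$. Let $\{\mathbb{Q}_n(t)\}_{n\geqslant0}$ be the monic orthogonal polynomial system for $W_t$ with three term relation matrices $E_{n,1}(t),E_{n,2}(t)$ (see context), and set $\mathbf{E}_n(t)=E_{n,1}(t)+E_{n,2}(t)$ for $n\geqslant1$ and $$V_{n+1}(t)=L_{n,1}E_{n+1,1}(t)+L_{n,2}E_{n+1,2}(t)+E_{n,1}(t)L_{n-1,1}+E_{n,2}(t)L_{n-1,2}.$$ Then for all $n\geqslant1$, $$\dot{\mathbf{E}}_n(t)=V_{n+1}(t)\mathbf{E}_n(t)-\mathbf{E}_n(t)V_n(t),$$ where the dot denotes derivative with respect to $t$.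
   Context: $\mathbb{X}_n=(x^n,x^{n-1}y,\dots,y^n)^T$. $L_{n,1}=(I_{n+1}\,|\,0)$ and $L_{n,2}=(0\,|\,I_{n+1})$ are $(n+1)\times(n+2)$ matrices (so $x\mathbb{X}_n=L_{n,1}\mathbb{X}_{n+1}$, $y\mathbb{X}_n=L_{n,2}\mathbb{X}_{n+1}$). Inner product $(f,g)_t=\iint_{\mathbb{R}^2}fgW_t\,dx\,dy$, applied entrywise to vectors. The monic orthogonal polynomial system is the sequence of column vectors $\mathbb{Q}_n(t)=\mathbb{X}_n+(\text{vector of polynomials of total degree}<n)$, with coefficients depending on $t$, such that $(\mathbb{Q}_n(t),\mathbb{Q}_m(t)^T)_t=0$ for $m\neq n$ and $H_n(t):=(\mathbb{Q}_n(t),\mathbb{Q}_n(t)^T)_t$ is symmetric positive definite. It satisfies, for $n\geqslant0$, $x\mathbb{Q}_n(t)=L_{n,1}\mathbb{Q}_{n+1}(t)+E_{n,1}(t)\mathbb{Q}_{n-1}(t)$ and $y\mathbb{Q}_n(t)=L_{n,2}\mathbb{Q}_{n+1}(t)+E_{n,2}(t)\mathbb{Q}_{n-1}(t)$, with $\mathbb{Q}_{-1}=0$, $\mathbb{Q}_0=1$, and $E_{n,i}(t)$ of size $(n+1)\times n$ (with $E_{0,i}$ taken as zero).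
   Formalization: Instead of all real t, the parameter t ranges over an open set on which all moments of W_t are assumed finite and the monic orthogonal system exists; if a_{4,0}=0 or a_{0,4}=0 the integral of W_t diverges for t≥0, so the system is undefined there. *)

(* Defs.v *)
From HB Require Import structures.
From mathcomp Require Import all_boot all_order all_algebra.
From mathcomp Require Import all_classical all_reals all_analysis.
Set Implicit Arguments.
Unset Strict Implicit.
Unset Printing Implicit Defensive.
Import Order.TTheory GRing.Theory Num.Theory.
Import numFieldNormedType.Exports.
Local Open Scope classical_set_scope.
Local Open Scope ring_scope.

Section Defs.
Variable R : realType.

Definition leb2 := ((@lebesgue_measure R) \x (@lebesgue_measure R))%E.

Definition Wt (a40 a22 a04 t x y : R) : R :=
  expR (- (a40 * x ^+ 4 + a22 * x ^+ 2 * y ^+ 2 + a04 * y ^+ 4)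
        + t * (x ^+ 2 + y ^+ 2)).

Definition Xvec (n : nat) (x y : R) : 'cV[R]_n.+1 :=
  \col_(i < n.+1) (x ^+ (n - i) * y ^+ i).

(* Lmat1 k = (I_k | 0), Lmat2 k = (0 | I_k), both k x (k+1);
   L_{n,1} = Lmat1 n.+1, L_{n,2} = Lmat2 n.+1. *)
Definition Lmat1 (k : nat) : 'M[R]_(k, k.+1) :=
  \matrix_(i < k, j < k.+1) (i == j :> nat)%:R.
Definition Lmat2 (k : nat) : 'M[R]_(k, k.+1) :=
  \matrix_(i < k, j < k.+1) (j == i.+1 :> nat)%:R.

Definition monic_polyvec (n : nat) (q : R -> R -> 'cV[R]_n.+1) : Prop :=
  exists C : forall k : 'I_n, 'M[R]_(n.+1, k.+1),
    forall x y, q x y = Xvec n x y + \sum_(k < n) C k *m Xvec k x y.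

Definition ipW (a40 a22 a04 t : R) (m p : nat)
  (f : R -> R -> 'cV[R]_m) (g : R -> R -> 'cV[R]_p) : 'M[R]_(m, p) :=
  \matrix_(i < m, j < p)
    Rintegral leb2 setT (fun z : R * R =>
      f z.1 z.2 i 0 * g z.1 z.2 j 0 * Wt a40 a22 a04 t z.1 z.2).

Definition posdef (m : nat) (A : 'M[R]_m) : Prop :=
  A^T = A /\ forall v : 'cV[R]_m, v != 0 -> 0 < (v^T *m A *m v) 0 0.

Definition prevQ (Q : forall n : nat, R -> R -> 'cV[R]_n.+1) (n : nat)
  (x y : R) : 'cV[R]_n :=
  match n return 'cV[R]_n with
  | 0 => 0
  | m.+1 => Q m x y
  end.

(* Vmat E1 E2 n = V_{n+1}
   = L_{n,1} E_{n+1,1} + L_{n,2} E_{n+1,2} + E_{n,1} L_{n-1,1} + E_{n,2} L_{n-1,2} *)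
Definition Vmat (E1 E2 : forall n : nat, 'M[R]_(n.+1, n)) (n : nat)
  : 'M[R]_n.+1 :=
  Lmat1 n.+1 *m E1 n.+1 + Lmat2 n.+1 *m E2 n.+1
  + E1 n *m Lmat1 n + E2 n *m Lmat2 n.

End Defs.

(* Main.v *)
(** Write [H_n] for the Gram matrix of [Q_n] and [E_n = E_(n,1) + E_(n,2)].  The three term relations give
    [E_n H_(n-1) = H_n (L_1 + L_2)^T] and [((x^2 + y^2) Q_n, Q_n)_t = V_(n+1) H_n].
    The weight satisfies [dW_t/dt = (x^2 + y^2) W_t]; on a compact interval of [t]
    this is dominated by its value at the right end point, so inner products of fixed
    polynomials may be differentiated under the integral.  Gram-Schmidt makes
    [s |-> (f, Q_n(s))_s] differentiable by induction on [n], and since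
    [Q_n(s) - Q_n(t)] has degree [< n], it does not contribute to
    [H_n(s) = (Q_n(t), Q_n(s))_s] to first order at [s = t], whence
    [dH_n/dt = V_(n+1) H_n].  Differentiating the first relation gives the claim. *)

Require Import Defs.
From HB Require Import structures.
From mathcomp Require Import all_boot all_order all_algebra.
From mathcomp Require Import perm.
From mathcomp Require Import all_classical all_reals all_analysis.
Import Order.TTheory GRing.Theory Num.Theory.
Import numFieldNormedType.Exports.
Local Open Scope classical_set_scope.
Local Open Scope ring_scope.

Set Implicit Arguments.
Unset Strict Implicit.

(** * Entrywise derivatives of matrices *)

Section MatrixDerivative.
Variable R : realType.
Implicit Type t : R.

Lemma is_derive_bigsum (I : Type) (r : seq I) (P : pred I) (h : I -> R -> R)
    (dh : I -> R) t :
  (forall i, is_derive t 1 (h i) (dh i)) ->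
  is_derive t 1 (fun s => \sum_(i <- r | P i) h i s) (\sum_(i <- r | P i) dh i).
Proof.
move=> hd; elim: r => [|i r IH].
  rewrite big_nil (_ : (fun _ => _) = cst 0); first exact: is_derive_cst.
  by apply/funext => s; rewrite big_nil.
rewrite big_cons; case: ifP => Pi.
  rewrite (_ : (fun _ => _) = h i + (fun s => \sum_(i <- r | P i) h i s)).
    exact: is_deriveD.
  by apply/funext => s; rewrite big_cons Pi.
rewrite (_ : (fun _ => _) = (fun s => \sum_(i <- r | P i) h i s)) //.
by apply/funext => s; rewrite big_cons Pi.
Qed.

Lemma derivable_bigprod (I : Type) (r : seq I) (P : pred I) (h : I -> R -> R) t :
  (forall i, derivable (h i) t 1) ->
  derivable (fun s => \prod_(i <- r | P i) h i s) t 1.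
Proof.
move=> hd; elim: r => [|i r IH].
  rewrite (_ : (fun _ => _) = cst 1); first exact: derivable_cst.
  by apply/funext => s; rewrite big_nil.
case Pi: (P i).
  rewrite (_ : (fun _ => _) = h i * (fun s => \prod_(i <- r | P i) h i s)).
    exact: derivableM.
  by apply/funext => s; rewrite big_cons Pi.
rewrite (_ : (fun _ => _) = (fun s => \prod_(i <- r | P i) h i s)) //.
by apply/funext => s; rewrite big_cons Pi.
Qed.

(** The Leibniz formula is a finite signed sum over permutations of products of entries, so the sum
    and product rules suffice. *)
Lemma derivable_det n (A : R -> 'M[R]_n) t :
  (forall i j, derivable (fun s => A s i j) t 1) ->
  derivable (fun s => \det (A s)) t 1.
Proof.
move=> dA.
pose h (p : 'S_n) := cst ((-1) ^+ p) * (fun s => \prod_i A s i (p i)) : R -> R.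
suff dh p : derivable (h p) t 1.
  by have [] := is_derive_bigsum (index_enum _) xpredT (fun p => derivableP (dh p)).
apply: derivableM; first exact: derivable_cst.
exact: derivable_bigprod.
Qed.

(** Taken entrywise, so that scalar calculus applies and no norm on matrices enters. *)
Definition mxderive m n (F : R -> 'M[R]_(m, n)) t (F' : 'M[R]_(m, n)) :=
  forall i j, is_derive t 1 (fun s => F s i j) (F' i j).

Definition mxderivable m n (F : R -> 'M[R]_(m, n)) t :=
  forall i j, derivable (fun s => F s i j) t 1.

Lemma mxderivableP m n (F : R -> 'M[R]_(m, n)) t :
  mxderivable F t -> mxderive F t (\matrix_(i, j) 'D_1 (fun s => F s i j) t).
Proof. by move=> dF i j; rewrite mxE; apply: derivableP. Qed.

Lemma mxderive_derivable m n (F : R -> 'M[R]_(m, n)) t F' :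
  mxderive F t F' -> mxderivable F t.
Proof. by move=> dF i j; case: (dF i j). Qed.

Lemma mxderive_uniq m n (F : R -> 'M[R]_(m, n)) t A B :
  mxderive F t A -> mxderive F t B -> A = B.
Proof.
move=> dA dB; apply/matrixP => i j.
by rewrite -(@derive_val _ _ _ _ _ _ _ (dA i j)) (@derive_val _ _ _ _ _ _ _ (dB i j)).
Qed.

Lemma mxderive_near m n (F G : R -> 'M[R]_(m, n)) t F' :
  (\near t, F t = G t) -> mxderive F t F' -> mxderive G t F'.
Proof.
move=> FG dF i j; apply: near_eq_is_derive (dF i j).
by near=> s; rewrite (near FG s).
Unshelve. all: end_near. Qed.

Lemma mxderive_cst m n (A : 'M[R]_(m, n)) t : mxderive (fun=> A) t 0.
Proof. by move=> i j; rewrite mxE; apply: is_derive_cst. Qed.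

Lemma mxderiveB m n (F G : R -> 'M[R]_(m, n)) t F' G' :
  mxderive F t F' -> mxderive G t G' ->
  mxderive (fun s => F s - G s) t (F' - G').
Proof.
move=> dF dG i j; rewrite !mxE.
rewrite (_ : (fun _ => _) = (fun s => F s i j) - (fun s => G s i j)).
  exact: is_deriveB.
by apply/funext => s; rewrite !mxE.
Qed.

Lemma mxderive_sum m n k (F : 'I_k -> R -> 'M[R]_(m, n)) t F' :
  (forall l, mxderive (F l) t (F' l)) ->
  mxderive (fun s => \sum_(l < k) F l s) t (\sum_(l < k) F' l).
Proof.
move=> dF i j; rewrite summxE.
under eq_fun do rewrite summxE.
by apply: is_derive_bigsum => l; apply: dF.
Qed.

Lemma mxderiveM m n p (F : R -> 'M[R]_(m, n)) (G : R -> 'M[R]_(n, p)) t F' G' :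
  mxderive F t F' -> mxderive G t G' ->
  mxderive (fun s => F s *m G s) t (F' *m G t + F t *m G').
Proof.
move=> dF dG i j; rewrite !mxE -big_split/=.
under eq_fun do rewrite mxE.
apply: is_derive_bigsum => l.
apply: is_derive_eq (is_deriveM (dF i l) (dG l j)) _.
by rewrite addrC; congr (_ + _); rewrite /GRing.scale/= mulrC.
Qed.

Lemma mxderive_tr m n (F : R -> 'M[R]_(m, n)) t F' :
  mxderive F t F' -> mxderive (fun s => (F s)^T) t F'^T.
Proof.
move=> dF i j; rewrite mxE.
by under eq_fun do rewrite mxE.
Qed.

(** Near [t] the inverse is the adjugate divided by the determinant. Invertibility is asked on a
    neighbourhood because [invmx] returns a singular matrix unchanged. *)
Lemma mxderivable_inv n (A : R -> 'M[R]_n) t :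
  (\near t, A t \in unitmx) -> mxderivable A t ->
  mxderivable (fun s => invmx (A s)) t.
Proof.
move=> uA dA i j.
pose B s := (\det (A s))^-1 * cofactor (A s) j i.
apply: (@near_eq_derivable _ _ _ B).
  by near=> s; rewrite /invmx (near uA s) // !mxE.
have uAt : A t \in unitmx := nbhs_singleton uA.
apply: (@derivableM _ _ (fun s => (\det (A s))^-1) (fun s => cofactor (A s) j i)).
  by apply: derivableV; [rewrite -unitfE -unitmxE | exact: derivable_det].
apply: (@derivableM _ _ (cst ((-1) ^+ (j + i)))
  (fun s => \det (row' j (col' i (A s))))); first exact: derivable_cst.
apply: derivable_det => k l.
by under eq_fun do rewrite !mxE; exact: dA.
Unshelve. all: end_near. Qed.

End MatrixDerivative.

(** * Moments of the weight *)

Section PolynomialFunctions.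
Variable R : realType.
Implicit Types (f g : R -> R -> R).

(** The outer indeterminate of [P] stands for [x], the inner one for [y]. *)
Definition bpoly f :=
  exists P : {poly {poly R}}, forall x y, f x y = P.[x%:P].[y].

Lemma bpoly_cst (c : R) : bpoly (fun _ _ => c).
Proof. by exists c%:P%:P => x y; rewrite !hornerC. Qed.

Lemma bpoly_fst : bpoly (fun x _ => x).
Proof. by exists 'X => x y; rewrite hornerX hornerC. Qed.

Lemma bpoly_snd : bpoly (fun _ y => y).
Proof. by exists ('X%:P) => x y; rewrite hornerC hornerX. Qed.

Lemma bpolyD f g : bpoly f -> bpoly g -> bpoly (fun x y => f x y + g x y).
Proof.
by move=> [P fP] [S gS]; exists (P + S) => x y; rewrite !hornerD fP gS.
Qed.

Lemma bpolyM f g : bpoly f -> bpoly g -> bpoly (fun x y => f x y * g x y).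
Proof.
by move=> [P fP] [S gS]; exists (P * S) => x y; rewrite !hornerM fP gS.
Qed.

Lemma bpolyX f n : bpoly f -> bpoly (fun x y => f x y ^+ n).
Proof.
by move=> [P fP]; exists (P ^+ n) => x y; rewrite !horner_exp fP.
Qed.

Lemma bpoly_sum (I : Type) (r : seq I) (P : pred I) (F : I -> R -> R -> R) :
  (forall i, bpoly (F i)) -> bpoly (fun x y => \sum_(i <- r | P i) F i x y).
Proof.
move=> /choice[p Fp]; exists (\sum_(i <- r | P i) p i) => x y.
by rewrite !horner_sum; apply: eq_bigr => i _; exact: Fp.
Qed.

Lemma bpoly_sqnorm : bpoly (fun x y => x ^+ 2 + y ^+ 2).
Proof. by apply: bpolyD; apply: bpolyX; [exact: bpoly_fst|exact: bpoly_snd]. Qed.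

Definition pvec m (f : R -> R -> 'cV[R]_m) :=
  forall i, bpoly (fun x y => f x y i 0).

Lemma pvecD m (f g : R -> R -> 'cV[R]_m) :
  pvec f -> pvec g -> pvec (fun x y => f x y + g x y).
Proof.
move=> pf pg i; rewrite (_ : (fun _ _ => _) = fun x y => f x y i 0 + g x y i 0).
  exact: bpolyD.
by apply/funext => x; apply/funext => y; rewrite mxE.
Qed.

Lemma pvecM m n (A : 'M[R]_(m, n)) (f : R -> R -> 'cV[R]_n) :
  pvec f -> pvec (fun x y => A *m f x y).
Proof.
move=> pf i.
rewrite (_ : (fun _ _ => _) = fun x y => \sum_j A i j * f x y j 0).
  by apply: bpoly_sum => j; apply: bpolyM; [exact: bpoly_cst|exact: pf].
by apply/funext => x; apply/funext => y; rewrite mxE.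
Qed.

Lemma pvecZ m g (f : R -> R -> 'cV[R]_m) :
  bpoly g -> pvec f -> pvec (fun x y => g x y *: f x y).
Proof.
move=> pg pf i; rewrite (_ : (fun _ _ => _) = fun x y => g x y * f x y i 0).
  exact: bpolyM.
by apply/funext => x; apply/funext => y; rewrite mxE.
Qed.

Lemma pvec_sum m (I : Type) (r : seq I) (P : pred I) (F : I -> R -> R -> 'cV[R]_m) :
  (forall i, pvec (F i)) -> pvec (fun x y => \sum_(i <- r | P i) F i x y).
Proof.
move=> pF j.
rewrite (_ : (fun _ _ => _) = fun x y => \sum_(i <- r | P i) F i x y j 0).
  by apply: bpoly_sum => i; exact: pF.
by apply/funext => x; apply/funext => y; rewrite summxE.
Qed.

Lemma pvec_Xvec n : pvec (@Xvec R n).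
Proof.
move=> i; rewrite (_ : (fun _ _ => _) = fun x y => x ^+ (n - i) * y ^+ i).
  by apply: bpolyM; apply: bpolyX; [exact: bpoly_fst|exact: bpoly_snd].
by apply/funext => x; apply/funext => y; rewrite mxE.
Qed.

Lemma pvec_monic n (q : R -> R -> 'cV[R]_n.+1) : monic_polyvec q -> pvec q.
Proof.
move=> [C qC].
rewrite (_ : q = fun x y => Xvec n x y + \sum_(k < n) C k *m Xvec k x y).
  apply: pvecD; first exact: pvec_Xvec.
  by apply: pvec_sum => k; apply: pvecM; exact: pvec_Xvec.
by apply/funext => x; apply/funext => y.
Qed.

End PolynomialFunctions.

(** * Integrals of polynomials against the weight *)

Section Moments.
Variables (R : realType) (a40 a22 a04 : R).
Notation W := (Wt a40 a22 a04).
Notation ip := (ipW a40 a22 a04).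

Definition Wintegrable t (f : R -> R -> R) := (@leb2 R).-integrable setT
  (fun z : R * R => (f z.1 z.2 * W t z.1 z.2)%:E).

Definition Wint t (f : R -> R -> R) :=
  Rintegral (@leb2 R) setT (fun z : R * R => f z.1 z.2 * W t z.1 z.2).

Lemma WintegrableD t f g : Wintegrable t f -> Wintegrable t g ->
  Wintegrable t (fun x y => f x y + g x y).
Proof.
move=> fW gW; rewrite /Wintegrable.
under eq_fun do rewrite mulrDl EFinD.
exact: integrableD.
Qed.

Lemma WintegrableZ t c f : Wintegrable t f ->
  Wintegrable t (fun x y => c * f x y).
Proof.
move=> fW; rewrite /Wintegrable.
under eq_fun do rewrite -mulrA EFinM.
exact: integrableZl.
Qed.

Lemma Wintegrable_sum t (I : Type) (r : seq I) (F : I -> R -> R -> R) :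
  (forall i, Wintegrable t (F i)) ->
  Wintegrable t (fun x y => \sum_(i <- r) F i x y).
Proof.
move=> iF; elim: r => [|i r IH].
  rewrite /Wintegrable; under eq_fun do rewrite big_nil mul0r.
  exact: integrable0.
rewrite (_ : (fun _ _ => _) = fun x y => F i x y + \sum_(i <- r) F i x y).
  exact: WintegrableD.
by apply/funext => x; apply/funext => y; rewrite big_cons.
Qed.

Lemma WintD t f g : Wintegrable t f -> Wintegrable t g ->
  Wint t (fun x y => f x y + g x y) = Wint t f + Wint t g.
Proof.
move=> fW gW; rewrite /Wint.
under eq_Rintegral do rewrite mulrDl.
by rewrite RintegralD.
Qed.

Lemma WintZ t c f : Wintegrable t f ->
  Wint t (fun x y => c * f x y) = c * Wint t f.
Proof.
move=> fW; rewrite /Wint.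
under eq_Rintegral do rewrite -mulrA.
by rewrite RintegralZl.
Qed.

Lemma Wint_sum t (I : Type) (r : seq I) (F : I -> R -> R -> R) :
  (forall i, Wintegrable t (F i)) ->
  Wint t (fun x y => \sum_(i <- r) F i x y) = \sum_(i <- r) Wint t (F i).
Proof.
move=> iF; elim: r => [|i r IH].
  rewrite big_nil /Wint; under eq_Rintegral do rewrite big_nil mul0r.
  by rewrite /Rintegral integral0.
rewrite big_cons -IH -WintD //; last exact: Wintegrable_sum.
by congr Wint; apply/funext => x; apply/funext => y; rewrite big_cons.
Qed.

Variable D : set R.
Hypothesis hD : open D.
Hypothesis hint : forall t, D t -> forall i j : nat,
  Wintegrable t (fun x y => x ^+ i * y ^+ j).

(** A polynomial is a finite combination of monomials, whose integrability is the moment hypothesis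
    [hint]. *)
Lemma bpoly_Wintegrable t f : D t -> bpoly f -> Wintegrable t f.
Proof.
move=> Dt [P fP].
rewrite (_ : f = fun x y => \sum_(i < size P) \sum_(j < size P`_i)
    P`_i`_j * (x ^+ i * y ^+ j)); last first.
  apply/funext => x; apply/funext => y; rewrite fP (horner_coef P) horner_sum.
  apply: eq_bigr => i _; rewrite hornerM horner_exp hornerC horner_coef mulr_suml.
  by apply: eq_bigr => j _; rewrite -mulrA (mulrC (x ^+ i)).
do 2 (apply: Wintegrable_sum => ?).
exact/WintegrableZ/hint.
Qed.

Lemma is_derive_W (x y t : R) :
  is_derive t 1 (fun s => W s x y) ((x ^+ 2 + y ^+ 2) * W t x y).
Proof.
rewrite /Wt; set c := - _; set r := x ^+ 2 + y ^+ 2.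
have dlin : is_derive t (1 : R) (fun s => c + s * r) r.
  rewrite (_ : (fun _ => _) = cst c + r *: id); last first.
    by apply/funext => s; rewrite /GRing.scale/= !fctE mulrC.
  apply: is_derive_eq (is_deriveD _ _) _; rewrite add0r.
  by rewrite /GRing.scale/= mulr1.
apply: is_derive_eq (is_derive1_comp (is_derive_expR _) dlin) _.
by rewrite mulrC.
Qed.

(** Dominated differentiation: [W s] is nondecreasing in [s], so its value at a point of [D] to the
    right of [t] controls the integrand's derivative on a neighbourhood of [t]. *)
Lemma is_derive_Wint t f : D t -> bpoly f ->
  is_derive t 1 (fun s => Wint s f) (Wint t (fun x y => (x ^+ 2 + y ^+ 2) * f x y)).
Proof.
move=> Dt pf.
have [e /= e0 eD] : nbhs t D by exact: open_nbhs_nbhs.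
(* Halving the radius keeps both end points in [D]; the dominating function [G] is taken at [v]. *)
pose u := t - e / 2; pose v := t + e / 2.
have e20 : 0 < e / 2 by rewrite divr_gt0.
have DI (s : R) : u <= s -> s <= v -> D s.
  move=> us sv; apply: eD => /=; rewrite ltr_norml; apply/andP; split.
    rewrite ltrBrDr addrC -ltrBrDr; apply: le_lt_trans sv _.
    by rewrite /v opprK ltrD2l ltr_pdivrMr// ltr_pMr// ltr1n.
  rewrite ltrBlDr addrC -ltrBlDr; apply: lt_le_trans us.
  by rewrite /u ltrD2l ltrN2 ltr_pdivrMr// ltr_pMr// ltr1n.
have uv : u <= v by rewrite lerD2l (le_trans _ (ltW e20))// oppr_le0 ltW.
pose F s (z : R * R) := f z.1 z.2 * W s z.1 z.2.
pose G (z : R * R) : R := `|(z.1 ^+ 2 + z.2 ^+ 2) * f z.1 z.2 * W v z.1 z.2|.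
have dF (s : R) (z : R * R) :
    is_derive s 1 (F ^~ z) ((z.1 ^+ 2 + z.2 ^+ 2) * f z.1 z.2 * W s z.1 z.2).
  rewrite (_ : F ^~ z = f z.1 z.2 *: (fun s => W s z.1 z.2)) //.
  apply: is_derive_eq (is_deriveZ _ (is_derive_W _ _ _)) _.
  by rewrite /GRing.scale/= mulrCA mulrA.
have It : `]u, v[%classic t.
  by rewrite /= in_itv/= ltrBlDr !ltrDl e20.
have IF (s : R) : `]u, v[%classic s -> (@leb2 R).-integrable setT (EFin \o F s).
  rewrite /= in_itv/= => /andP[us sv].
  by apply: bpoly_Wintegrable => //; apply: DI; exact: ltW.
have dF' (s : R) (z : R * R) : `]u, v[%classic s -> setT z -> derivable (F ^~ z) s 1.
  by move=> _ _; case: (dF s z).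
have G0 z : 0 <= G z by exact: normr_ge0.
have IG : (@leb2 R).-integrable setT (EFin \o G).
  have Dv : D v by exact: DI.
  have := bpoly_Wintegrable Dv (bpolyM (bpoly_sqnorm R) pf).
  by move/integrable_abse.
have FG (s : R) (z : R * R) :
    `]u, v[%classic s -> setT z -> `|partial1of2 F s z| <= G z.
  rewrite /= in_itv/= => /andP[us sv] _.
  rewrite partial1of2E (@derive_val _ _ _ _ _ _ _ (dF s z)) /G.
  (* With the common polynomial factor removed, the bound is [W s <= W v], which holds because [t]
     multiplies a sum of squares in the exponent. *)
  rewrite normrM [leRHS]normrM ler_wpM2l//.
  rewrite !ger0_norm ?expR_ge0// ler_expR lerD2l ler_wpM2r ?(ltW sv)//.
  by rewrite addr_ge0 ?sqr_ge0.
have dW := derivable_under_integral measurableT It IF dF' G0 IG FG.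
have eW := differentiation_under_integral measurableT It IF dF' G0 IG FG.
apply: DeriveDef => //.
rewrite -derive1E eW /Wint; apply: eq_Rintegral => z _.
by rewrite partial1of2E (@derive_val _ _ _ _ _ _ _ (dF t z)).
Qed.

(** * The matrix-valued inner product *)

Section InnerProduct.

Lemma ipWE t m p (f : R -> R -> 'cV[R]_m) (g : R -> R -> 'cV[R]_p) i j :
  ip t f g i j = Wint t (fun x y => f x y i 0 * g x y j 0).
Proof. by rewrite mxE. Qed.

Lemma ipW_tr t m p (f : R -> R -> 'cV[R]_m) (g : R -> R -> 'cV[R]_p) :
  (ip t f g)^T = ip t g f.
Proof.
apply/matrixP => i j; rewrite !mxE; apply: eq_Rintegral => z _.
by rewrite (mulrC (f _ _ _ _)).
Qed.

Lemma ipW_mulC t m p (h : R -> R -> R) (f : R -> R -> 'cV[R]_m)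
    (g : R -> R -> 'cV[R]_p) :
  ip t (fun x y => h x y *: f x y) g = ip t f (fun x y => h x y *: g x y).
Proof.
apply/matrixP => i j; rewrite !mxE; apply: eq_Rintegral => z _.
by rewrite !mxE mulrCA !mulrA.
Qed.

Variable t : R.
Hypothesis Dt : D t.

Lemma ipWDl m p (f g : R -> R -> 'cV[R]_m) (h : R -> R -> 'cV[R]_p) :
  pvec f -> pvec g -> pvec h ->
  ip t (fun x y => f x y + g x y) h = ip t f h + ip t g h.
Proof.
move=> pf pg ph; apply/matrixP => i j; rewrite [RHS]mxE !ipWE -WintD.
- by congr Wint; apply/funext => x; apply/funext => y; rewrite mxE mulrDl.
- by apply: bpoly_Wintegrable => //; exact: bpolyM.
- by apply: bpoly_Wintegrable => //; exact: bpolyM.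
Qed.

Lemma ipWMl m n p (A : 'M[R]_(m, n)) (f : R -> R -> 'cV[R]_n)
    (h : R -> R -> 'cV[R]_p) : pvec f -> pvec h ->
  ip t (fun x y => A *m f x y) h = A *m ip t f h.
Proof.
move=> pf ph; apply/matrixP => i j; rewrite [RHS]mxE ipWE.
under [RHS]eq_bigr do rewrite ipWE.
have fh k : Wintegrable t (fun x y => f x y k 0 * h x y j 0).
  by apply: bpoly_Wintegrable => //; exact: bpolyM.
under [RHS]eq_bigr do rewrite -WintZ//.
rewrite -Wint_sum; last by move=> k; exact: WintegrableZ.
congr Wint; apply/funext => x; apply/funext => y; rewrite mxE mulr_suml.
by apply: eq_bigr => k _; rewrite mulrA.
Qed.

Lemma ipW_suml m p k (f : 'I_k -> R -> R -> 'cV[R]_m) (h : R -> R -> 'cV[R]_p) :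
  (forall l, pvec (f l)) -> pvec h ->
  ip t (fun x y => \sum_(l < k) f l x y) h = \sum_(l < k) ip t (f l) h.
Proof.
move=> pf ph; apply/matrixP => i j; rewrite summxE ipWE.
under [RHS]eq_bigr do rewrite ipWE.
rewrite -Wint_sum; last first.
  by move=> l; apply: bpoly_Wintegrable => //; apply: bpolyM; [exact: pf|].
by congr Wint; apply/funext => x; apply/funext => y; rewrite summxE mulr_suml.
Qed.

(** Since [f] and [g] are fixed, only the weight is differentiated. *)
Lemma mxderive_ipW m p (f : R -> R -> 'cV[R]_m) (g : R -> R -> 'cV[R]_p) :
  pvec f -> pvec g ->
  mxderive (fun s => ip s f g) t
    (ip t (fun x y => (x ^+ 2 + y ^+ 2) *: f x y) g).
Proof.
move=> pf pg i j; rewrite ipWE.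
under eq_fun do rewrite ipWE.
apply: is_derive_eq (is_derive_Wint Dt (bpolyM (pf i) (pg j))) _.
by congr Wint; apply/funext => x; apply/funext => y; rewrite mxE mulrA.
Qed.

End InnerProduct.
End Moments.

(** * Monic orthogonal systems *)

(** A nonzero row vector in the left kernel would, once transposed, make the quadratic form
    vanish. *)
Lemma posdef_unitmx (R : realType) n (A : 'M[R]_n) : posdef A -> A \in unitmx.
Proof.
move=> [_ Apos]; rewrite unitmxE unitfE; apply/det0P => -[v v0 vA0].
have := Apos v^T; rewrite trmx_eq0 => /(_ v0).
by rewrite trmxK vA0 mul0mx mxE ltxx.
Qed.

Section MonicOrthogonalSystem.
Variables (R : realType) (a40 a22 a04 : R) (D : set R).
Notation ip := (ipW a40 a22 a04).
Hypothesis hD : open D.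
Hypothesis hint : forall t, D t -> forall i j : nat,
  Wintegrable a40 a22 a04 t (fun x y => x ^+ i * y ^+ j).
Variable Q : R -> forall n : nat, R -> R -> 'cV[R]_n.+1.
Hypothesis hmonic : forall t, D t -> forall n, monic_polyvec (Q t n).
Hypothesis horth : forall t, D t -> forall n m, n <> m ->
  ip t (Q t n) (Q t m) = 0.
Hypothesis hH : forall t, D t -> forall n, posdef (ip t (Q t n) (Q t n)).

Notation H s n := (ip s (Q s n) (Q s n)).
Notation r2 x y := (x ^+ 2 + y ^+ 2).

Lemma pvecQ s n : D s -> pvec (Q s n).
Proof. by move=> Ds; apply: pvec_monic; exact: hmonic. Qed.
Arguments pvecQ {s} n _ i.

Lemma gram_unitmx s n : D s -> H s n \in unitmx.
Proof. by move=> Ds; apply: posdef_unitmx; exact: hH. Qed.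

Lemma gram_sym s n : (H s n)^T = H s n.
Proof. exact: ipW_tr. Qed.

(** * Fourier expansions at a fixed parameter *)

Section FixedParameter.
Variable s : R.
Hypothesis Ds : D s.

(* [f] has entries in the span of the entries of [Q s k] for [k < n], encoded as
   equality of [f] with its own Fourier expansion. *)
Definition qspan n m (f : R -> R -> 'cV[R]_m) :=
  pvec f /\ forall x y,
    f x y = \sum_(k < n) ip s f (Q s k) *m invmx (H s k) *m Q s k x y.

Lemma qspanD n m (f g : R -> R -> 'cV[R]_m) :
  qspan n f -> qspan n g -> qspan n (fun x y => f x y + g x y).
Proof.
move=> [pf fE] [pg gE]; split; first exact: pvecD.
move=> x y; rewrite [in LHS]fE [in LHS]gE -big_split /=.
apply: eq_bigr => k _.
by rewrite (ipWDl hint Ds pf pg (pvecQ k Ds)) !mulmxDl.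
Qed.

Lemma qspanM n m p (A : 'M[R]_(m, p)) (f : R -> R -> 'cV[R]_p) :
  qspan n f -> qspan n (fun x y => A *m f x y).
Proof.
move=> [pf fE]; split; first exact: pvecM.
move=> x y; rewrite [in LHS]fE mulmx_sumr.
apply: eq_bigr => k _.
by rewrite (ipWMl hint Ds A pf (pvecQ k Ds)) !mulmxA.
Qed.

Lemma qspan0 n m : qspan n (fun _ _ => 0 : 'cV[R]_m).
Proof.
have p0 : pvec (fun _ _ => 0 : 'cV[R]_m).
  by move=> i; rewrite mxE; exact: bpoly_cst.
split => // x y; rewrite big1 // => k _.
rewrite (_ : ip _ _ _ = 0) ?mul0mx //.
rewrite (_ : (fun _ _ => _) = fun x y => 0 *m (0 : 'cV[R]_m)).
  by rewrite (ipWMl hint Ds (0 : 'M[R]_m) p0 (pvecQ k Ds)) mul0mx.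
by apply/funext => ?; apply/funext => ?; rewrite mul0mx.
Qed.

Lemma qspan_sum n m (I : Type) (r : seq I) (F : I -> R -> R -> 'cV[R]_m) :
  (forall l, qspan n (F l)) -> qspan n (fun x y => \sum_(l <- r) F l x y).
Proof.
move=> qF; elim: r => [|l r IH].
  rewrite (_ : (fun _ _ => _) = fun _ _ => 0); first exact: qspan0.
  by apply/funext => x; apply/funext => y; rewrite big_nil.
rewrite (_ : (fun _ _ => _) = fun x y => F l x y + \sum_(i <- r) F i x y).
  exact: qspanD.
by apply/funext => x; apply/funext => y; rewrite big_cons.
Qed.

(** Orthogonality leaves only the coefficient of index [k], a Gram matrix times its inverse. *)
Lemma qspanQ n k : (k < n)%N -> qspan n (Q s k).
Proof.
move=> kn; split; first exact: pvecQ.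
move=> x y; rewrite (bigD1 (Ordinal kn)) //= mulmxV ?gram_unitmx // mul1mx.
rewrite big1 ?addr0 // => l lk.
rewrite horth ?mul0mx //.
by move=> kl; move: lk; rewrite -val_eqE /= kl eqxx.
Qed.

Lemma qspan_orth n m k (f : R -> R -> 'cV[R]_m) :
  qspan n f -> (n <= k)%N -> ip s f (Q s k) = 0.
Proof.
move=> [pf fE] nk.
have -> : f = fun x y =>
    \sum_(l < n) (ip s f (Q s l) *m invmx (H s l)) *m Q s l x y.
  by apply/funext => x; apply/funext => y; exact: fE.
rewrite (ipW_suml hint) //; [|by move=> l; apply/pvecM/pvecQ|exact: pvecQ].
rewrite big1 // => l _.
rewrite (ipWMl hint) //; [|exact: pvecQ|exact: pvecQ].
rewrite (_ : ip s (Q s l) (Q s k) = 0) ?mulmx0 ?horth // => lk.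
by move: nk; rewrite -lk leqNgt ltn_ord.
Qed.

(** The added terms have index at least [n], so [qspan_orth] makes their coefficients zero. *)
Lemma qspan_widen n n' m (f : R -> R -> 'cV[R]_m) :
  (n <= n')%N -> qspan n f -> qspan n' f.
Proof.
move=> nn' qf; have [pf fE] := qf; split => // x y.
rewrite fE (big_ord_widen n'
  (fun k => ip s f (Q s k) *m invmx (H s k) *m Q s k x y)) //.
rewrite [in RHS](bigID (fun k : 'I_n' => (k < n)%N)) /=.
rewrite [X in _ = _ + X]big1 ?addr0 // => k; rewrite -leqNgt => nk.
by rewrite (qspan_orth qf nk) !mul0mx.
Qed.

(** Strong induction: monicity writes [Xvec n] as [Q s n] minus combinations of monomials of lower
    degree. *)
Lemma qspan_Xvec n : qspan n.+1 (@Xvec R n).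
Proof.
elim/ltn_ind: n => n IH.
have [C QE] := hmonic Ds n.
rewrite (_ : @Xvec R n = fun x y =>
    Q s n x y + \sum_(k < n) - C k *m Xvec k x y); last first.
  apply/funext => x; apply/funext => y; rewrite QE -addrA -big_split /=.
  by rewrite big1 ?addr0 // => k _; rewrite mulNmx subrr.
apply: qspanD; first exact: qspanQ.
apply: qspan_sum => k; apply: qspanM.
by apply: qspan_widen (IH k (ltn_ord k)); apply: leqW.
Qed.

(** The leading monomials cancel, leaving combinations of [Xvec k] with [k < n]. *)
Lemma qspan_monicB n (p q : R -> R -> 'cV[R]_n.+1) :
  monic_polyvec p -> monic_polyvec q -> qspan n (fun x y => p x y - q x y).
Proof.
move=> [A pE] [B qE].
rewrite (_ : (fun _ _ => _) = fun x y =>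
    \sum_(k < n) (A k - B k) *m Xvec k x y); last first.
  apply/funext => x; apply/funext => y; rewrite pE qE opprD addrACA subrr add0r.
  by rewrite -sumrB; apply: eq_bigr => k _; rewrite mulmxBl.
by apply: qspan_sum => k; apply/qspanM/(qspan_widen _ (qspan_Xvec k)).
Qed.

(** The difference of [p] and [Q s n] has lower degree, hence is orthogonal to [Q s n]. This allows
    the left factor of the Gram matrix to be frozen at another parameter. *)
Lemma ip_monicQ n (p : R -> R -> 'cV[R]_n.+1) :
  monic_polyvec p -> ip s p (Q s n) = H s n.
Proof.
move=> mp; have qd := qspan_monicB mp (hmonic Ds n).
have -> : p = fun x y => Q s n x y + (p x y - Q s n x y).
  by apply/funext => x; apply/funext => y; rewrite addrC subrK.
have [pd _] := qd.
by rewrite (ipWDl hint Ds (pvecQ n Ds) pd (pvecQ n Ds)) (qspan_orth qd) // addr0.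
Qed.

Lemma Xvec_monic n : monic_polyvec (@Xvec R n).
Proof.
by exists (fun=> 0) => x y; rewrite big1 ?addr0 // => k _; rewrite mul0mx.
Qed.

Definition gs_coef n k : 'M[R]_(n.+1, k.+1) :=
  ip s (@Xvec R n) (Q s k) *m invmx (H s k).

Lemma gram_schmidt n x y :
  Xvec n x y = Q s n x y + \sum_(k < n) gs_coef n k *m Q s k x y.
Proof.
have [pd dE] := qspan_monicB (Xvec_monic n) (hmonic Ds n).
(* Subtracting [Q s n] does not change the coefficients of index [k < n], by orthogonality. *)
have dX (k : 'I_n) :
    ip s (fun x y => Xvec n x y - Q s n x y) (Q s k) = ip s (@Xvec R n) (Q s k).
  have XE : @Xvec R n = fun x y => Q s n x y + (Xvec n x y - Q s n x y).
    by apply/funext => u; apply/funext => v; rewrite addrC subrK.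
  rewrite [in RHS]XE (ipWDl hint Ds (pvecQ n Ds) pd (pvecQ k Ds)) horth ?add0r //.
  by move=> nk; have := ltn_ord k; rewrite -nk ltnn.
rewrite -[LHS](subrK (Q s n x y)) addrC; congr (_ + _).
by rewrite [LHS]dE; apply: eq_bigr => k _; rewrite dX.
Qed.

(** Trades the moving vector [Q s n] for fixed monomials and the vectors [Q s k] with [k < n], which
    prepares the induction for differentiating in [s]. *)
Lemma ip_gram_schmidt n m (f : R -> R -> 'cV[R]_m) : pvec f ->
  ip s f (Q s n) =
  ip s f (@Xvec R n) - \sum_(k < n) ip s f (Q s k) *m (gs_coef n k)^T.
Proof.
move=> pf; rewrite -[ip s f (@Xvec R n)]ipW_tr.
have -> : @Xvec R n = fun x y => Q s n x y + \sum_(k < n) gs_coef n k *m Q s k x y.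
  by apply/funext => x; apply/funext => y; exact: gram_schmidt.
have pg k : pvec (fun x y => gs_coef n k *m Q s k x y) by exact/pvecM/pvecQ.
rewrite (ipWDl hint) //; [|exact: pvecQ|by apply: pvec_sum => k; exact: pg].
rewrite (ipW_suml hint) // linearD /= ipW_tr.
rewrite linear_sum /= -addrA -sumrB big1 ?addr0 // => k _.
by rewrite (ipWMl hint) ?trmx_mul ?ipW_tr ?subrr //; exact: pvecQ.
Qed.

(** * Consequences of one three term relation, for either coordinate *)

Section ThreeTerm.
Variables (h : R -> R -> R) (L : forall n, 'M[R]_(n, n.+1))
  (E : forall n, 'M[R]_(n.+1, n)).
Hypothesis ph : bpoly h.
Hypothesis rec : forall n x y,
  h x y *: Q s n x y = L n.+1 *m Q s n.+1 x y + E n *m prevQ (Q s) n x y.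

Lemma pvec_prevQ n : pvec (prevQ (Q s) n).
Proof. by case: n => [[]//|n]; exact: pvecQ. Qed.

Lemma ip_three_term n m (g : R -> R -> 'cV[R]_m) : pvec g ->
  ip s (fun x y => h x y *: Q s n x y) g =
  L n.+1 *m ip s (Q s n.+1) g + E n *m ip s (prevQ (Q s) n) g.
Proof.
move=> pg.
have -> : (fun x y => h x y *: Q s n x y) =
    fun x y => L n.+1 *m Q s n.+1 x y + E n *m prevQ (Q s) n x y.
  by apply/funext => x; apply/funext => y; exact: rec.
have pQ := pvecQ n.+1 Ds; have pQ' := pvec_prevQ (n := n).
rewrite (ipWDl hint) //; [|exact: pvecM|exact: pvecM].
by rewrite !(ipWMl hint).
Qed.

Lemma ip_three_term_lower n :
  ip s (fun x y => h x y *: Q s n.+1 x y) (Q s n) = E n.+1 *m H s n.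
Proof.
rewrite ip_three_term; last exact: pvecQ.
by rewrite horth ?mulmx0 ?add0r // => nn; have := leqnSn n.+1; rewrite nn ltnn.
Qed.

Lemma ip_three_term_upper n :
  ip s (fun x y => h x y *: Q s n x y) (Q s n.+1) = L n.+1 *m H s n.+1.
Proof.
rewrite ip_three_term; last exact: pvecQ.
(* For [n = 0] the matrix [E 0] has no columns, so the lower term vanishes. *)
case: n => [|n] /=; first by rewrite (thinmx0 (E 0)) mul0mx addr0.
have -> : ip s (Q s n) (Q s n.+2) = 0.
  by apply: horth => // nn; have := leqnSn n.+1; rewrite -nn ltnn.
by rewrite mulmx0 addr0.
Qed.

(** Both sides compute the inner product of [h Q_(n+1)] with [Q_n]: the left one directly, the right
    one by moving [h] to the other factor and transposing. *)
Lemma three_term_gram n : E n.+1 *m H s n = H s n.+1 *m (L n.+1)^T.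
Proof.
rewrite -ip_three_term_lower ipW_mulC -ipW_tr ip_three_term_upper trmx_mul.
by rewrite gram_sym.
Qed.

(** One factor [h] is moved to the right, the left argument is expanded by the recurrence, and [h]
    is moved back in each term. The bracket is the share of one coordinate in $V_{n+1}$. *)
Lemma ip_three_term_sq n : ip s (fun x y => h x y ^+ 2 *: Q s n x y) (Q s n) =
  (L n.+1 *m E n.+1 + E n *m L n) *m H s n.
Proof.
have -> : (fun x y => h x y ^+ 2 *: Q s n x y) =
    fun x y => h x y *: (h x y *: Q s n x y).
  by apply/funext => x; apply/funext => y; rewrite scalerA.
rewrite ipW_mulC ip_three_term; last exact/pvecZ/pvecQ.
rewrite -!ipW_mulC ip_three_term_lower mulmxDl mulmxA; congr (_ + _).
case: n => [|n]; first by rewrite (thinmx0 (E 0)) !mul0mx.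
by rewrite ip_three_term_upper mulmxA.
Qed.

End ThreeTerm.
End FixedParameter.

(** * Dependence on the parameter *)

Section Derivatives.
Variable t : R.
Hypothesis Dt : D t.

Let nearD : \near t, D t.
Proof. exact: open_nbhs_nbhs. Qed.

(** Quantified over all fixed [f] so that the induction on [n] can insert both [Xvec] and
    [Q t m]. *)
Let ipQ_derivable n := forall m (f : R -> R -> 'cV[R]_m), pvec f ->
  mxderivable (fun s => ip s f (Q s n)) t.

Lemma gram_derivable n : ipQ_derivable n -> mxderivable (fun s => H s n) t.
Proof.
move=> /(_ _ _ (pvecQ n Dt)) /mxderivableP dQ.
apply: mxderive_derivable; apply: mxderive_near dQ.
by near=> s; apply: ip_monicQ; [near: s | exact: hmonic].
Unshelve. all: end_near. Qed.

Lemma gs_coef_derivable n k : ipQ_derivable k -> mxderivable (fun s => gs_coef s n k) t.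
Proof.
move=> dk; apply: mxderive_derivable; apply: mxderiveM.
  exact/mxderivableP/dk/pvec_Xvec.
apply/mxderivableP/mxderivable_inv; last exact: gram_derivable.
by near=> s; apply: gram_unitmx; near: s.
Unshelve. all: end_near. Qed.

(* Although [Q s n] varies with [s], its variation is of lower degree, so it does
   not contribute when paired with [Q t m], [m >= n]. *)
Lemma ipQ_derive n : ipQ_derivable n /\ forall m, (n <= m)%N ->
  mxderive (fun s => ip s (Q t m) (Q s n)) t
    (ip t (fun x y => r2 x y *: Q t m x y) (Q t n)).
Proof.
elim/ltn_ind: n => n IH.
have dk (k : 'I_n) : ipQ_derivable k by have [] := IH _ (ltn_ord k).
pose A' (k : 'I_n) := (\matrix_(i, j) 'D_1 (fun s => gs_coef s n k i j) t)^T.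
have dA (k : 'I_n) : mxderive (fun s => (gs_coef s n k)^T) t (A' k).
  exact/mxderive_tr/mxderivableP/gs_coef_derivable/dk.
(* Differentiates [ip_gram_schmidt]: the weight alone moves in the monomial term, and the product
   rule handles the sum. *)
have dGS m (f : R -> R -> 'cV[R]_m) (Df : forall k : 'I_n, 'M[R]_(m, k.+1)) :
    pvec f ->
    (forall k : 'I_n, mxderive (fun s => ip s f (Q s k)) t (Df k)) ->
    mxderive (fun s => ip s f (Q s n)) t
      (ip t (fun x y => r2 x y *: f x y) (@Xvec R n) -
       \sum_(k < n) (Df k *m (gs_coef t n k)^T + ip t f (Q t k) *m A' k)).
  move=> pf df.
  have := mxderiveB (mxderive_ipW hD hint Dt pf (@pvec_Xvec R n))
    (mxderive_sum (fun k => mxderiveM (df k) (dA k))).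
  apply: mxderive_near.
  by near=> s; rewrite ip_gram_schmidt //; near: s.
split.
  move=> m f pf; apply: mxderive_derivable; apply: (dGS _ _ _ pf) => k.
  by apply: mxderivableP; apply: dk.
move=> m nm.
have pQ := pvecQ m Dt.
have dQ (k : 'I_n) := (IH _ (ltn_ord k)).2 m (leq_trans (ltnW (ltn_ord k)) nm).
have := dGS _ _ _ pQ dQ.
(* The unknown derivatives [A' k] are multiplied by pairings of [Q t m] with [Q t k], which vanish
   as [k < n <= m]. What remains is the Gram-Schmidt identity at [t] for [r2] times [Q t m]. *)
rewrite ip_gram_schmidt //; last exact: pvecZ (bpoly_sqnorm R) pQ.
congr (mxderive _ _ (_ - _)); apply: eq_bigr => k _.
rewrite horth ?mul0mx ?addr0 // => mk.
by have := leq_trans (ltn_ord k) nm; rewrite mk ltnn.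
Unshelve. all: end_near. Qed.

Lemma gram_derive n :
  mxderive (fun s => H s n) t (ip t (fun x y => r2 x y *: Q t n x y) (Q t n)).
Proof.
apply: mxderive_near ((ipQ_derive n).2 n (leqnn n)).
by near=> s; apply: ip_monicQ; [near: s | exact: hmonic].
Unshelve. all: end_near. Qed.

End Derivatives.
End MonicOrthogonalSystem.

(** * The evolution equation for the three term coefficients *)

Unset Implicit Arguments.
Set Strict Implicit.

Theorem theorem6p2 (R : realType) (a40 a22 a04 : R)
  (ha40 : 0 <= a40) (ha22 : 0 <= a22) (ha04 : 0 <= a04)
  (h1 : 0 < a40 + a22) (h2 : 0 < a22 + a04)
  (D : set R) (hD : open D)
  (Q : R -> forall n : nat, R -> R -> 'cV[R]_n.+1)
  (E1 E2 : R -> forall n : nat, 'M[R]_(n.+1, n))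
  (hint : forall t, D t -> forall i j : nat,
     (@leb2 R).-integrable setT
       (fun z : R * R => (z.1 ^+ i * z.2 ^+ j * Wt a40 a22 a04 t z.1 z.2)%:E))
  (hmonic : forall t, D t -> forall n, monic_polyvec (Q t n))
  (horth : forall t, D t -> forall n m, n <> m ->
     ipW a40 a22 a04 t (Q t n) (Q t m) = 0)
  (hH : forall t, D t -> forall n, posdef (ipW a40 a22 a04 t (Q t n) (Q t n)))
  (hrec1 : forall t, D t -> forall n x y,
     x *: Q t n x y = Lmat1 R n.+1 *m Q t n.+1 x y + E1 t n *m prevQ (Q t) n x y)
  (hrec2 : forall t, D t -> forall n x y,
     y *: Q t n x y = Lmat2 R n.+1 *m Q t n.+1 x y + E2 t n *m prevQ (Q t) n x y) :
  forall t, D t -> forall m : nat, forall (i : 'I_m.+2) (j : 'I_m.+1),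
    let Eb := fun s : R => E1 s m.+1 + E2 s m.+1 in
    derivable (fun s : R => Eb s i j) t 1 /\
    derive1 (fun s : R => Eb s i j) t =
      (Vmat (E1 t) (E2 t) m.+1 *m Eb t - Eb t *m Vmat (E1 t) (E2 t) m) i j.
Proof.
move=> t Dt m i j Eb.
pose H s n := ipW a40 a22 a04 s (Q s n) (Q s n).
pose L := Lmat1 R m.+1 + Lmat2 R m.+1.
(* Index shift: [V n] is $V_{n+1}$, so with $n = m+1$ the matrices $V_{n+1}$ and $V_n$ are [V m.+1]
   and [V m]. *)
pose V := Vmat (E1 t) (E2 t).
have nearD : \near t, D t by exact: open_nbhs_nbhs.
have Hunit s n : D s -> H s n \in unitmx by exact: gram_unitmx.
have EbH s : D s -> Eb s *m H s m = H s m.+1 *m L^T.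
  move=> Ds; rewrite mulmxDl linearD mulmxDr /=; congr (_ + _).
    exact: (three_term_gram (L := @Lmat1 R) hint hmonic horth Ds (hrec1 s Ds)).
  exact: (three_term_gram (L := @Lmat2 R) hint hmonic horth Ds (hrec2 s Ds)).
(* The factor [r2] is split into the squares of the two coordinates, whose contributions add up to
   [V n]. *)
have dH n : mxderive (fun s => H s n) t (V n *m H t n).
  have := gram_derive hD hint hmonic horth hH Dt (n := n).
  rewrite (_ : (fun _ _ => _ *: _) =
      fun x y => x ^+ 2 *: Q t n x y + y ^+ 2 *: Q t n x y); last first.
    by apply/funext => x; apply/funext => y; rewrite scalerDl.
  have pQ := pvecQ hmonic (n := n) Dt.
  have pX := bpolyX 2 (bpoly_fst R); have pY := bpolyX 2 (bpoly_snd R).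
  rewrite (ipWDl hint) //; [|exact: pvecZ|exact: pvecZ].
  rewrite (ip_three_term_sq (L := @Lmat1 R) hint hmonic horth Dt (bpoly_fst R) (hrec1 t Dt)).
  rewrite (ip_three_term_sq (L := @Lmat2 R) hint hmonic horth Dt (bpoly_snd R) (hrec2 t Dt)).
  by rewrite -mulmxDl addrACA addrA.
(* Existence comes from solving [EbH] for [Eb] near [t]; the value is found afterwards, without
   differentiating the inverse explicitly. *)
have [E' dE] : exists E', mxderive Eb t E'.
  have dI : mxderivable (fun s => invmx (H s m)) t.
    apply: mxderivable_inv; last exact: mxderive_derivable (dH m).
    by near=> s; apply: Hunit; near: s.
  eexists; apply: mxderive_near
    (mxderiveM (mxderiveM (dH m.+1) (mxderive_cst L^T t)) (mxderivableP dI)).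
  near=> s; have Ds : D s by near: s.
  by rewrite -EbH // mulmxK // Hunit.
have E'E : E' = V m.+1 *m Eb t - Eb t *m V m.
  (* Right multiplication by the invertible [H t m] is injective, so both sides may be compared
     after it. *)
  apply: (can_inj (mulmxK (Hunit t m Dt))).
  have dL := mxderiveM dE (dH m).
  have dR := mxderiveM (dH m.+1) (mxderive_cst L^T t).
  have dLR : mxderive (fun s => H s m.+1 *m L^T) t
      (E' *m H t m + Eb t *m (V m *m H t m)).
    by apply: mxderive_near dL; near=> s; apply: EbH; near: s.
  (* Equating the derivatives of the two sides of [EbH] gives $E' H_m + E V_{m+1} H_m = V_{m+2}
     H_{m+1} L^T$ with $E$ for [Eb t]; using [EbH] again, the right side is $V_{m+2} E H_m$. *)
  have := mxderive_uniq dLR dR.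
  rewrite mulmx0 addr0 -mulmxA -EbH // !mulmxA.
  by move=> /(canRL (addrK _)); rewrite /= mulmxBl.
have := dE i j; rewrite E'E => dEij; split; first by case: dEij.
by rewrite derive1E (@derive_val _ _ _ _ _ _ _ dEij).
Unshelve. all: end_near. Qed.
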